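(* Let $\mathbf{A}\in\mathbb{R}^{d\times d}$ be symmetric with smallest and largest eigenvalues $\lambda_{\min},\lambda_{\max}$, let $\mathcal{I}=[\lambda_{\min},\lambda_{\max}]$, let $\mathbf{b}\in\mathbb{R}^d$, let $k\ge1$ be an integer, and let $f$ be a real-valued function on $\mathcal{I}$. Let $\mathcal{R}$ be a nonempty set of real rational functions without poles in $\mathcal{I}$, and suppose that for each $r\in\mathcal{R}$ there are constants $C_r\ge1$ and $c_r\le1$ (depending on $r$) such that $$\|r(\mathbf{A})\mathbf{b}-\mathsf{lan}_k(r;\mathbf{A},\mathbf{b})\|_2\le C_r\min_{\deg(p)<c_rk}\|r(\mathbf{A})\mathbf{b}-p(\mathbf{A})\mathbf{b}\|_2.$$ Then $$\|f(\mathbf{A})\mathbf{b}-\mathsf{lan}_k(f;\mathbf{A},\mathbf{b})\|_2\le\inf_{r\in\mathcal{R}}\Big((C_r+2)\,\|\mathbf{b}\|_2\cdot\|f-r\|_{\mathcal{I}}+C_r\min_{\deg(p)<c_rk}\|f(\mathbf{A})\mathbf{b}-p(\mathbf{A})\mathbf{b}\|_2\Big).$$ Here the minima are over real polynomials $p$ of degree less than $c_rk$.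
   Context: For a symmetric matrix $\mathbf{M}=\sum_i\mu_i\mathbf{u}_i\mathbf{u}_i^{\mathsf T}$ (orthonormal eigendecomposition) and a scalar function $f$ defined on its eigenvalues, $f(\mathbf{M}):=\sum_i f(\mu_i)\mathbf{u}_i\mathbf{u}_i^{\mathsf T}$. The Krylov subspace is $\mathcal{K}_k(\mathbf{A},\mathbf{b})=\operatorname{span}\{\mathbf{b},\mathbf{A}\mathbf{b},\dots,\mathbf{A}^{k-1}\mathbf{b}\}$. Let $\mathbf{Q}$ be the matrix whose columns are the orthonormal basis of $\mathcal{K}_k(\mathbf{A},\mathbf{b})$ produced by the Lanczos algorithm in exact arithmetic (Gram–Schmidt applied to $\mathbf{b},\mathbf{A}\mathbf{b},\dots$; it has $\dim\mathcal{K}_k(\mathbf{A},\mathbf{b})$ columns), and let $\mathbf{T}=\mathbf{Q}^{\mathsf T}\mathbf{A}\mathbf{Q}$, which is symmetric tridiagonal with eigenvalues in $\mathcal{I}$. The Lanczos-FA iterate is $\mathsf{lan}_k(f;\mathbf{A},\mathbf{b}):=\mathbf{Q}f(\mathbf{T})\mathbf{Q}^{\mathsf T}\mathbf{b}$. The uniform norm is $\|g\|_{\mathcal{I}}:=\sup_{x\in\mathcal{I}}|g(x)|$ (a maximum when attained; possibly $+\infty$). The zero polynomial has degree $-\infty$. *)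

(* Defs.v *)
From HB Require Import structures.
From mathcomp Require Import all_boot all_order all_algebra.
From mathcomp Require Import all_classical all_reals ereal.

Set Implicit Arguments.
Unset Strict Implicit.
Unset Printing Implicit Defensive.

Import Order.TTheory GRing.Theory Num.Theory.

Local Open Scope classical_set_scope.
Local Open Scope ring_scope.

Section Defs.
Variable R : realType.

(* The library norm on matrices is the max norm, hence this definition. *)
Definition norm2 d (v : 'cV[R]_d) : R := Num.sqrt (\sum_i v i 0 ^+ 2).

(* [e.1] holds the eigenvectors (as columns), [e.2] the eigenvalues. *)
Definition eigendecomposition n (M : 'M[R]_n) (e : 'M[R]_n * 'rV[R]_n) : Prop :=
  e.1^T *m e.1 = 1%:M /\
  M = \sum_i e.2 0 i *: (col i e.1 *m (col i e.1)^T).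

(* For symmetric [M] an eigendecomposition exists, and the value below does not
   depend on the one that is chosen. Only the values of [f] on the spectrum of
   [M] matter. *)
Definition matfun (f : R -> R) n (M : 'M[R]_n) : 'M[R]_n :=
  let e := xget (0, 0) [set e | eigendecomposition M e] in
  \sum_i f (e.2 0 i) *: (col i e.1 *m (col i e.1)^T).

Definition gram_schmidt_step d (qs : seq 'cV[R]_d) (v : 'cV[R]_d) :
    seq 'cV[R]_d :=
  let w := v - \sum_(q <- qs) (q^T *m v) 0 0 *: q in
  if w == 0 then qs else rcons qs ((norm2 w)^-1 *: w).

(* Linearly dependent vectors are skipped, so the length of this sequence is the
   dimension of the Krylov subspace. *)
Definition lanczos_basis d (A : 'M[R]_d) (b : 'cV[R]_d) (k : nat) :
    seq 'cV[R]_d :=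
  foldl (@gram_schmidt_step d) [::] [seq A ^+ j *m b | j <- iota 0 k].

Definition lanczos_Q d (A : 'M[R]_d) (b : 'cV[R]_d) (k : nat) :
    'M[R]_(d, size (lanczos_basis A b k)) :=
  \matrix_(i, j) (lanczos_basis A b k)`_j i 0.

Definition lanczos_T d (A : 'M[R]_d) (b : 'cV[R]_d) (k : nat) :
    'M[R]_(size (lanczos_basis A b k)) :=
  (lanczos_Q A b k)^T *m A *m lanczos_Q A b k.

Definition lan d (k : nat) (f : R -> R) (A : 'M[R]_d) (b : 'cV[R]_d) : 'cV[R]_d :=
  lanczos_Q A b k *m matfun f (lanczos_T A b k) *m (lanczos_Q A b k)^T *m b.

Definition ratfun_num (r : {fraction {poly R}}) : {poly R} :=
  \n_(repr r) %/ gcdp \n_(repr r) \d_(repr r).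

Definition ratfun_den (r : {fraction {poly R}}) : {poly R} :=
  \d_(repr r) %/ gcdp \n_(repr r) \d_(repr r).

Definition ratfun_pole (r : {fraction {poly R}}) (x : R) : bool :=
  root (ratfun_den r) x.

(* The value at a pole is the junk value 0. *)
Definition ratfun_eval (r : {fraction {poly R}}) (x : R) : R :=
  (ratfun_num r).[x] / (ratfun_den r).[x].

Definition deg (p : {poly R}) : \bar R :=
  if p == 0 then -oo%E else (size p).-1%:R%:E.

(* The least element, with junk value 0 when there is none. *)
Definition minimum (S : set R) : R := xget 0 [set m | S m /\ lbound S m].

(* The set is never empty (it contains the error of the zero polynomial), and the
   minimum is attained since the vectors [p(A) b] form a linear subspace. *)
Definition min_poly_error d (A : 'M[R]_d) (b v : 'cV[R]_d) (t : R) : R :=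
  minimum [set norm2 (v - matfun (horner p) A *m b)
          | p in [set p : {poly R} | (deg p < t%:E)%E]].

Definition unif_norm (I : set R) (g : R -> R) : \bar R :=
  ereal_sup [set `|g x|%:E | x in I].

End Defs.

(* Main.v *)
Require Import Defs.
From mathcomp Require Import all_boot all_order all_algebra.
From mathcomp Require Import all_classical all_reals ereal.
From mathcomp Require Import spectral sesquilinear complex ring lra zify.
Set Implicit Arguments.
Unset Strict Implicit.
Unset Printing Implicit Defensive.
Import Order.TTheory GRing.Theory Num.Theory.
Local Open Scope classical_set_scope.
Local Open Scope ring_scope.

(** Fix [r] in [RR], write [U] for the uniform norm of [f - r], and assume it
    finite. The error splits as

      (f(A) b - r(A) b) + (r(A) b - lan r) + (lan r - lan f).

    The first vector has norm at most [U * norm2 b], because a function of a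
    symmetric matrix multiplies the coordinates in an orthonormal eigenbasis
    ([norm2_matfun_le]). The same bound holds for the third one
    ([norm2_lan_diff_le]): the columns of [Q] are orthonormal, so neither [Q]
    nor its transpose increases norms, and the eigenvalues of [T], being Rayleigh
    quotients of [A], stay in [[lmin, lmax]] ([eigenvalue_compression]). The
    second vector is bounded by the near-optimality hypothesis, and the best
    polynomial [p] for [f(A) b] is a competitor for [r(A) b], at a cost of one
    more [U * norm2 b]; this is where the [C] of the factor [C + 2] comes from.

    Two existence results give the definitions their meaning. An orthonormal
    eigendecomposition exists ([eigendecomposition_ex]), so that [matfun] is not
    built on a default value. The minimum over polynomials is attained
    ([min_poly_error_spec]), since it is the distance to a linear subspace; the
    orthonormal bases needed for this are produced by the very Gram-Schmidt
    steps that define the Lanczos basis.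

    When [U] is infinite, the bound is infinite too unless [b = 0], and then the
    error vanishes. *)

(** * Inner product and Euclidean norm *)

Section InnerProduct.
Context {R : realType}.

Definition dot {d} (u v : 'cV[R]_d) : R := (u^T *m v) 0 0.

Lemma dotE {d} (u v : 'cV[R]_d) : dot u v = \sum_i u i 0 * v i 0.
Proof. by rewrite /dot mxE; apply: eq_bigr => i _; rewrite mxE. Qed.

Lemma mx_dot {d} (u v : 'cV[R]_d) : u^T *m v = (dot u v)%:M.
Proof. exact: mx11_scalar. Qed.

Lemma dotC {d} (u v : 'cV[R]_d) : dot u v = dot v u.
Proof. by rewrite !dotE; apply: eq_bigr => i _; rewrite mulrC. Qed.

Lemma dotDl {d} (u v w : 'cV[R]_d) : dot (u + v) w = dot u w + dot v w.
Proof. by rewrite /dot linearD mulmxDl mxE. Qed.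

Lemma dotZl {d} a (u w : 'cV[R]_d) : dot (a *: u) w = a * dot u w.
Proof. by rewrite /dot linearZ -scalemxAl mxE. Qed.

Lemma dotDr {d} (u v w : 'cV[R]_d) : dot w (u + v) = dot w u + dot w v.
Proof. by rewrite /dot mulmxDr mxE. Qed.

Lemma dotZr {d} a (u w : 'cV[R]_d) : dot w (a *: u) = a * dot w u.
Proof. by rewrite /dot -scalemxAr mxE. Qed.

Lemma dotNl {d} (u w : 'cV[R]_d) : dot (- u) w = - dot u w.
Proof. by rewrite -scaleN1r dotZl mulN1r. Qed.

Lemma dotNr {d} (u w : 'cV[R]_d) : dot w (- u) = - dot w u.
Proof. by rewrite -scaleN1r dotZr mulN1r. Qed.

Lemma dot_mulmx {m n} (B : 'M[R]_(m, n)) (u : 'cV_n) (v : 'cV_m) :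
  dot (B *m u) v = dot u (B^T *m v).
Proof. by rewrite /dot trmx_mul mulmxA. Qed.

Lemma dot_ge0 {d} (u : 'cV[R]_d) : 0 <= dot u u.
Proof. by rewrite dotE sumr_ge0 // => i _; rewrite -expr2 sqr_ge0. Qed.

Lemma dot_eq0 {d} (u : 'cV[R]_d) : (dot u u == 0) = (u == 0).
Proof.
apply/eqP/eqP => [|->]; last by rewrite /dot mulmx0 mxE.
rewrite dotE => /eqP; rewrite psumr_eq0; last by move=> i _; rewrite -expr2 sqr_ge0.
move=> /allP u0; apply/matrixP => i j; rewrite ord1 mxE.
by have := u0 i (mem_index_enum i); rewrite implyTb mulf_eq0 orbb => /eqP.
Qed.

Lemma dot_gt0 {d} (u : 'cV[R]_d) : (0 < dot u u) = (u != 0).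
Proof. by rewrite lt_def dot_ge0 andbT dot_eq0. Qed.

Lemma norm2_ge0 {d} (u : 'cV[R]_d) : 0 <= norm2 u.
Proof. exact: sqrtr_ge0. Qed.

Lemma norm2E {d} (u : 'cV[R]_d) : norm2 u = Num.sqrt (dot u u).
Proof. by rewrite /norm2 dotE; under eq_bigr do rewrite expr2. Qed.

Lemma sqr_norm2 {d} (u : 'cV[R]_d) : norm2 u ^+ 2 = dot u u.
Proof. by rewrite norm2E sqr_sqrtr ?dot_ge0. Qed.

Lemma norm2_eq0 {d} (u : 'cV[R]_d) : (norm2 u == 0) = (u == 0).
Proof. by rewrite -sqrf_eq0 sqr_norm2 dot_eq0. Qed.

Lemma norm2_dot {d e} (u : 'cV[R]_d) (v : 'cV[R]_e) :
  dot u u = dot v v -> norm2 u = norm2 v.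
Proof. by rewrite !norm2E => ->. Qed.

Lemma le_norm2 {d e} (u : 'cV[R]_d) (v : 'cV[R]_e) :
  (norm2 u <= norm2 v) = (dot u u <= dot v v).
Proof. by rewrite !norm2E ler_sqrt ?dot_ge0. Qed.

(** Expand the squared norm of [norm2 v *: u - norm2 u *: v], which is
    nonnegative. *)
Lemma cauchy_schwarz {d} (u v : 'cV[R]_d) : dot u v <= norm2 u * norm2 v.
Proof.
have [/eqP|u0] := eqVneq (norm2 u) 0.
  by rewrite norm2_eq0 => /eqP ->; rewrite dotC /dot mulmx0 mxE mulr_ge0 ?norm2_ge0.
have [/eqP|v0] := eqVneq (norm2 v) 0.
  by rewrite norm2_eq0 => /eqP ->; rewrite /dot mulmx0 mxE mulr_ge0 ?norm2_ge0.
have st : 0 < norm2 u * norm2 v by rewrite mulr_gt0 // lt_def norm2_ge0 andbT.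
have := dot_ge0 (norm2 v *: u - norm2 u *: v).
rewrite !(dotDl, dotDr, dotNl, dotNr, dotZl, dotZr) -!sqr_norm2 (dotC v u).
by move=> H; rewrite -(ler_pM2l st); lra.
Qed.

Lemma norm2D {d} (u v : 'cV[R]_d) : norm2 (u + v) <= norm2 u + norm2 v.
Proof.
rewrite -(@ler_pXn2r _ 2) ?nnegrE ?addr_ge0 ?norm2_ge0 //.
rewrite sqr_norm2 dotDl !dotDr (dotC v u) sqrrD -!sqr_norm2.
by have := cauchy_schwarz u v; lra.
Qed.

Lemma norm2N {d} (u : 'cV[R]_d) : norm2 (- u) = norm2 u.
Proof. by apply: norm2_dot; rewrite dotNl dotNr opprK. Qed.

Lemma norm2_isometry {d m} (Q : 'M[R]_(d, m)) (y : 'cV_m) :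
  Q^T *m Q = 1%:M -> norm2 (Q *m y) = norm2 y.
Proof.
by move=> QQ; apply: norm2_dot; rewrite dot_mulmx mulmxA QQ mul1mx.
Qed.

Lemma norm2_orthogonal {d} (u v : 'cV[R]_d) :
  dot v u = 0 -> norm2 u <= norm2 (u + v).
Proof.
move=> vu0; rewrite le_norm2.
have -> : dot (u + v) (u + v) = dot u u + dot v v.
  by rewrite dotDl !dotDr (dotC u v) vu0 addr0 add0r.
by rewrite lerDl dot_ge0.
Qed.

(** An orthogonal projection [Q *m Q^T] does not increase the norm. *)
Lemma norm2_tr_isometry {d m} (Q : 'M[R]_(d, m)) (x : 'cV_d) :
  Q^T *m Q = 1%:M -> norm2 (Q^T *m x) <= norm2 x.
Proof.
move=> QQ; rewrite -(norm2_isometry _ QQ).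
rewrite -[X in _ <= norm2 X](subrK (Q *m (Q^T *m x))) [X in _ <= norm2 X]addrC.
apply: norm2_orthogonal; rewrite dotC dot_mulmx mulmxBr (mulmxA Q^T Q) QQ mul1mx.
by rewrite subrr /dot mulmx0 mxE.
Qed.

End InnerProduct.

(** * Eigenvectors of real symmetric matrices *)

Section RealSymmetric.
Context {R : realType}.

(** Over the complex extension the matrix is Hermitian, hence diagonalizable
    with a real spectrum; a real root of the characteristic polynomial is an
    eigenvalue over the reals. *)
Lemma real_eigenvector {n} (M : 'M[R]_n) : M^T = M -> (0 < n)%N ->
  exists (a : R) (u : 'cV[R]_n), u != 0 /\ M *m u = a *: u.
Proof.
case: n M => // n M Msym _.
pose AC := map_mx (real_complex R) M.
have Ah : AC \is hermsymmx.
  apply/is_hermitianmxP; rewrite expr0 scale1r /AC -{1}Msym.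
  by apply/matrixP => i j; rewrite !mxE /=; rewrite conj_Creal // complex_real.
have Areal := hermitian_spectral_diag_real Ah.
have /orthomx_spectralP Aeq := hermitian_normalmx Ah.
have Pu := spectral_unit AC.
set P := spectralmx AC in Aeq Pu; set D := spectral_diag AC in Aeq Areal.
have eA : eigenvalue AC (D 0 0).
  apply/eigenvalueP; exists (row 0 P).
    by rewrite -row_mul Aeq !mulmxA mulmxV // mul1mx row_mul row_diag_mx
       -scalemxAl -rowE.
  by apply: contraTneq Pu => r0; rewrite -row_free_unit; apply/row_freePn; exists 0;
     rewrite r0 sub0mx.
have /complex_realP[a Da] : D 0 0 \is Num.real by have /mxOverP/(_ 0 0) := Areal.
move: eA; rewrite Da eigenvalue_root_char -map_char_poly fmorph_root.
rewrite -eigenvalue_root_char => /eigenvalueP[v vM v0].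
exists a, v^T; split; first by rewrite trmx_eq0.
by apply: trmx_inj; rewrite trmx_mul trmxK Msym vM linearZ /= trmxK.
Qed.

End RealSymmetric.
(** * Gram-Schmidt and orthogonal projections *)

Section Orthonormal.
Context {R : realType}.

Definition orthonormal {d} (qs : seq 'cV[R]_d) : Prop :=
  forall i j, (i < size qs)%N -> (j < size qs)%N -> dot qs`_i qs`_j = (i == j)%:R.

Definition cols {d} (qs : seq 'cV[R]_d) : 'M[R]_(d, size qs) :=
  \matrix_(i, j) qs`_j i 0.

Lemma col_cols {d} (qs : seq 'cV[R]_d) j : col j (cols qs) = qs`_j.
Proof. by apply/matrixP => i l; rewrite !mxE ord1. Qed.

Lemma tr_mulmxE {m n p} (B : 'M[R]_(m, n)) (C : 'M[R]_(m, p)) i j :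
  (B^T *m C) i j = dot (col i B) (col j C).
Proof. by rewrite dotE !mxE; apply: eq_bigr => l _; rewrite !mxE. Qed.

Lemma cols_isometry {d} (qs : seq 'cV[R]_d) :
  orthonormal qs -> (cols qs)^T *m cols qs = 1%:M.
Proof.
move=> on; apply/matrixP => i j.
by rewrite tr_mulmxE !col_cols on // !mxE.
Qed.

Lemma isometry_size {d m} (Q : 'M[R]_(d, m)) : Q^T *m Q = 1%:M -> (m <= d)%N.
Proof. by move=> QQ; rewrite -{1}(mxrank1 R m) -QQ mulmx_max_rank. Qed.

Lemma cols_mul {d} (qs : seq 'cV[R]_d) (y : 'cV_(size qs)) :
  cols qs *m y = \sum_(j < size qs) y j 0 *: qs`_j.
Proof.
apply/matrixP => i l; rewrite ord1 !mxE summxE; apply: eq_bigr => j _.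
by rewrite !mxE mulrC.
Qed.

Lemma cols_tr_mul {d} (qs : seq 'cV[R]_d) v j :
  ((cols qs)^T *m v) j 0 = dot qs`_j v.
Proof. by rewrite tr_mulmxE col_cols col_id. Qed.

(** This is the vector [w] of [gram_schmidt_step], in matrix form. *)
Definition residual {d} (qs : seq 'cV[R]_d) (v : 'cV[R]_d) : 'cV[R]_d :=
  v - cols qs *m ((cols qs)^T *m v).

Lemma gram_schmidt_stepE {d} (qs : seq 'cV[R]_d) v :
  let w := residual qs v in
  gram_schmidt_step qs v = if w == 0 then qs else rcons qs ((norm2 w)^-1 *: w).
Proof.
suff -> : residual qs v = v - \sum_(q <- qs) (q^T *m v) 0 0 *: q by [].
rewrite /residual cols_mul (big_nth 0) big_mkord; congr (v - _).
by apply: eq_bigr => j _; rewrite cols_tr_mul.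
Qed.

Lemma dot_residual {d} (qs : seq 'cV[R]_d) v i : orthonormal qs ->
  (i < size qs)%N -> dot qs`_i (residual qs v) = 0.
Proof.
move=> on lti; have QQ := cols_isometry on.
have /matrixP/(_ (Ordinal lti) 0) : (cols qs)^T *m residual qs v = 0.
  by rewrite mulmxBr !mulmxA QQ mul1mx subrr.
by rewrite cols_tr_mul mxE.
Qed.

Lemma orthonormal_gram_schmidt_step {d} (qs : seq 'cV[R]_d) v :
  orthonormal qs -> orthonormal (gram_schmidt_step qs v).
Proof.
move=> on; rewrite gram_schmidt_stepE; case: eqVneq => [//|w0].
set w := residual _ _ in w0 *.
have nw : norm2 w != 0 by rewrite norm2_eq0.
move=> i j; rewrite size_rcons !ltnS !nth_rcons.
rewrite leq_eqVlt => /predU1P[->|lti]; rewrite leq_eqVlt => /predU1P[->|ltj].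
- rewrite ltnn !eqxx dotZl dotZr -sqr_norm2 /=; by field.
- by rewrite ltnn eqxx ltj dotC dotZr dot_residual // mulr0 gtn_eqF.
- by rewrite ltnn eqxx lti dotZr dot_residual // mulr0 ltn_eqF.
- by rewrite lti ltj on.
Qed.

Lemma lanczos_isometry {d} (A : 'M[R]_d) b k :
  (lanczos_Q A b k)^T *m lanczos_Q A b k = 1%:M.
Proof.
apply: cols_isometry; rewrite /lanczos_basis.
have : orthonormal ([::] : seq 'cV[R]_d) by [].
elim: {b k}[seq _ | _ <- _] [::] => //= v vs IH qs on.
exact: IH (orthonormal_gram_schmidt_step on).
Qed.

(** As long as some vector of [D] has a nonzero residual, a Gram-Schmidt step
    lengthens the list; lists of orthonormal vectors have at most [d] terms. *)
Lemma subspace_basis {d} (D : 'cV[R]_d -> Prop) :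
  D 0 -> (forall a x y, D x -> D y -> D (a *: x + y)) ->
  exists m (Q : 'M[R]_(d, m)), [/\ Q^T *m Q = 1%:M,
    forall y : 'cV_m, D (Q *m y) & forall x, D x -> Q *m (Q^T *m x) = x].
Proof.
move=> D0 Dlin.
have DQ qs : (forall i, (i < size qs)%N -> D qs`_i) -> forall y, D (cols qs *m y).
  move=> Dqs y; rewrite cols_mul.
  apply: (big_ind D) => // [x z Dx Dz|j _]; first by rewrite -[x]scale1r; apply: Dlin.
  by rewrite -[X in D X]addr0; apply: Dlin => //; apply: Dqs.
(* The number [n] is fuel: [d - size qs] decreases with each new vector. *)
suff ex n (qs : seq 'cV[R]_d) : (d - size qs < n)%N -> orthonormal qs ->
    (forall i, (i < size qs)%N -> D qs`_i) ->
    exists qs', [/\ orthonormal qs', forall i, (i < size qs')%N -> D qs'`_i &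
      forall x, D x -> residual qs' x = 0].
  have [//|//|qs [on Dqs res]] := ex _ [::] (ltnSn _).
  exists (size qs), (cols qs); split; [exact: cols_isometry|exact: DQ|].
  by move=> x /res /eqP; rewrite subr_eq0 eq_sym => /eqP.
elim: n qs => // n IH qs ltn on Dqs.
have [full|/existsNP[x /not_implyP[Dx /eqP x0]]] :=
  pselect (forall x, D x -> residual qs x = 0); first by exists qs.
have := orthonormal_gram_schmidt_step (v := x) on.
rewrite gram_schmidt_stepE (negPf x0) => on'.
have := isometry_size (cols_isometry on'); rewrite size_rcons => ltd.
apply: IH on' _.
  by rewrite size_rcons; lia.
move=> i; rewrite size_rcons ltnS nth_rcons leq_eqVlt => /predU1P[->|lti].
  rewrite ltnn eqxx -[X in D X]addr0; apply: (Dlin) => //.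
  by rewrite /residual addrC -scaleN1r; apply: Dlin => //; apply: DQ.
by rewrite lti; apply: Dqs.
Qed.

(** The closest point is the orthogonal projection [Q *m Q^T *m v], for [Q] an
    orthonormal basis of [D]. *)
Lemma closest_point {d} (D : 'cV[R]_d -> Prop) v :
  D 0 -> (forall a x y, D x -> D y -> D (a *: x + y)) ->
  exists2 x0, D x0 & forall x, D x -> norm2 (v - x0) <= norm2 (v - x).
Proof.
move=> D0 Dlin; have [m [Q [QQ DQ Qx]]] := subspace_basis D0 Dlin.
exists (Q *m (Q^T *m v)) => // x /Qx <-.
set y := Q^T *m v; set z := Q^T *m x.
have -> : v - Q *m z = (v - Q *m y) + Q *m (y - z).
  by rewrite mulmxBr addrA subrK.
have orth : dot (Q *m (y - z)) (v - Q *m y) = 0.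
  by rewrite dot_mulmx mulmxBr mulmxA QQ mul1mx subrr /dot mulmx0 mxE.
exact: norm2_orthogonal.
Qed.

End Orthonormal.

(** * The spectral theorem *)

Section Spectral.
Context {R : realType}.

Lemma spectral_sum {n m} (V : 'M[R]_(n, m)) (g : 'rV_m) :
  \sum_i g 0 i *: (col i V *m (col i V)^T) = V *m diag_mx g *m V^T.
Proof.
apply/matrixP => i j; rewrite mul_mx_diag summxE !mxE; apply: eq_bigr => l _.
by rewrite !mxE big_ord1 !mxE mulrA (mulrC (V i l)).
Qed.

(** Orthonormal eigenvectors are found one at a time: the orthogonal complement
    of those already found is invariant under [M], and compressing [M] to it
    gives a smaller symmetric matrix, an eigenvector of which is pulled back. *)
Lemma eigendecomposition_ex {n} (M : 'M[R]_n) : M^T = M ->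
  exists e, eigendecomposition M e.
Proof.
move=> Msym.
(* For [m = n] the isometry [Q] is square, hence orthogonal. *)
suff ex m : (m <= n)%N -> exists (Q : 'M[R]_(n, m)) (a : 'rV[R]_m),
    Q^T *m Q = 1%:M /\ M *m Q = Q *m diag_mx a.
  have [Q [a [QQ MQ]]] := ex n (leqnn n).
  exists (Q, a); split=> //=.
  by rewrite spectral_sum -MQ -mulmxA (mulmx1C QQ) mulmx1.
elim: m => [_|m IH ltmn].
  by exists 0, 0; split; [apply/matrixP => -[]|apply/matrixP => i []].
have [Q [a [QQ MQ]]] := IH (ltnW ltmn).
pose D (x : 'cV[R]_n) := Q^T *m x = 0.
have D0 : D 0 by rewrite /D mulmx0.
have Dlin c x y : D x -> D y -> D (c *: x + y).
  by rewrite /D mulmxDr -scalemxAr => -> ->; rewrite scaler0 addr0.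
have DM x : D x -> D (M *m x).
  rewrite /D => Dx; rewrite -Msym mulmxA -trmx_mul MQ trmx_mul -mulmxA Dx.
  by rewrite mulmx0.
have [p [P [PP DP PD]]] := subspace_basis D0 Dlin.
(* [m < n] vectors do not span, so their orthogonal complement is not zero. *)
have p_gt0 : (0 < p)%N.
  case: p => // in P PP DP PD *.
  have : kermx Q != 0.
    by rewrite -mxrank_eq0 mxrank_ker subn_eq0 -ltnNge
       (leq_ltn_trans _ ltmn) // rank_leq_col.
  case/rowV0Pn => v /sub_kermxP vQ /eqP []; apply: trmx_inj; rewrite trmx0.
  rewrite -(PD v^T) ?thinmx0 ?mul0mx //.
  by apply: trmx_inj; rewrite /D trmx_mul !trmxK vQ trmx0.
have [|c [u [u0 Mu]]] := @real_eigenvector R p (P^T *m M *m P) _ p_gt0.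
  by rewrite !trmx_mul trmxK Msym mulmxA.
pose x := (norm2 u)^-1 *: (P *m u).
have Dx : Q^T *m x = 0 by rewrite /x -scalemxAr (DP u) scaler0.
have nu : norm2 u != 0 by rewrite norm2_eq0.
have xx : dot x x = 1.
  rewrite /x dotZl dotZr dot_mulmx mulmxA PP mul1mx -sqr_norm2; by field.
have Mx : M *m x = c *: x.
  rewrite /x -scalemxAr -(PD (M *m (P *m u)) (DM _ (DP u))).
  have -> : P^T *m (M *m (P *m u)) = c *: u by rewrite -Mu !mulmxA.
  by rewrite -scalemxAr !scalerA mulrC.
rewrite -addn1; exists (row_mx Q x), (row_mx a c%:M); split.
  rewrite tr_row_mx mul_col_row QQ Dx mx_dot xx -[X in block_mx _ _ X]trmxK.
  by rewrite trmx_mul trmxK Dx trmx0 -scalar_mx_block.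
rewrite mul_mx_row MQ Mx diag_mx_row mul_row_block !mulmx0 addr0 add0r.
by congr row_mx; rewrite mul_mx_diag; apply/matrixP => i j; rewrite !mxE ord1 mulr1n mulrC.
Qed.

End Spectral.

(** * Functions of symmetric matrices *)

Section MatrixFunctions.
Context {R : realType}.

Lemma matfun_spectral {n} (M : 'M[R]_n) : M^T = M ->
  exists (V : 'M[R]_n) (a : 'rV[R]_n), [/\ V^T *m V = 1%:M,
    forall i, eigenvalue M (a 0 i), M = V *m diag_mx a *m V^T &
    forall f, matfun f M = V *m diag_mx (\row_i f (a 0 i)) *m V^T].
Proof.
move=> /eigendecomposition_ex /(xgetPex (0, 0)) [].
set e := xget _ _; case E : e => [V a] /= VV; rewrite spectral_sum => Ma.
exists V, a; split=> // [i|f]; last first.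
  rewrite /matfun -/e E -spectral_sum /=; apply: eq_bigr => i _.
  by rewrite mxE.
apply/eigenvalueP; exists (row i V^T).
  rewrite Ma -row_mul !mulmxA VV mul1mx row_mul row_diag_mx -scalemxAl.
  by rewrite -rowE.
have : row i V^T *m V != 0.
  rewrite -row_mul VV; apply/eqP => /matrixP/(_ 0 i)/eqP.
  by rewrite !mxE eqxx oner_eq0.
by apply: contraNneq => ->; rewrite mul0mx.
Qed.

Lemma matfun_lin {n} (M : 'M[R]_n) a (f g : R -> R) :
  matfun (fun x => a * f x + g x) M = a *: matfun f M + matfun g M.
Proof.
rewrite /matfun scaler_sumr -big_split; apply: eq_bigr => i _ /=.
by rewrite scalerDl scalerA.
Qed.

Lemma matfunB {n} (M : 'M[R]_n) (f g : R -> R) :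
  matfun f M - matfun g M = matfun (fun x => f x - g x) M.
Proof.
by rewrite /matfun -sumrB; apply: eq_bigr => i _ /=; rewrite scalerBl.
Qed.

(** In an orthonormal eigenbasis the function acts by multiplying coordinates. *)
Lemma norm2_matfun_le {n} (M : 'M[R]_n) (g : R -> R) (U : R) (x : 'cV_n) :
  M^T = M -> (forall a, eigenvalue M a -> `|g a| <= U) ->
  norm2 (matfun g M *m x) <= U * norm2 x.
Proof.
move=> Msym; have [V [a [VV ea _ ->]]] := matfun_spectral Msym => gU.
have {}gU i : `|g (a 0 i)| <= U by exact: gU.
have [->|x0] := eqVneq x 0.
  by have /eqP n0 : norm2 (0 : 'cV[R]_n) == 0; rewrite ?norm2_eq0 // mulmx0 n0 mulr0.
(* As [x] is nonzero, [n] is positive and [M] has an eigenvalue. *)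
have U0 : 0 <= U.
  case: n M Msym V a VV ea gU x x0 => [M ? V a ? ? ? x|n M ? V a ? ? gU x _].
    by rewrite flatmx0 eqxx.
  exact: le_trans (normr_ge0 _) (gU 0).
rewrite -!mulmxA norm2_isometry //.
have -> : norm2 x = norm2 (V^T *m x).
  by rewrite norm2_isometry // trmxK (mulmx1C VV).
rewrite -(@ler_pXn2r _ 2) ?nnegrE ?mulr_ge0 ?norm2_ge0 //.
rewrite exprMn !sqr_norm2 !dotE mulr_sumr; apply: ler_sum => i _.
rewrite mul_diag_mx !mxE mulrACA -!expr2 ler_wpM2r ?sqr_ge0 //.
by rewrite -ler_sqrt ?sqr_ge0 // !sqrtr_sqr (ger0_norm U0).
Qed.

(** Rayleigh quotients: the eigenvector of the compression, mapped by [Q], has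
    the eigenvalue as its quotient, which is an average of eigenvalues of [A]. *)
Lemma eigenvalue_compression {d m} (A : 'M[R]_d) (Q : 'M[R]_(d, m)) (l u mu : R) :
  A^T = A -> Q^T *m Q = 1%:M ->
  (forall a, eigenvalue A a -> l <= a <= u) ->
  eigenvalue (Q^T *m A *m Q) mu -> l <= mu <= u.
Proof.
move=> Asym QQ lu /eigenvalueP[v vT v0].
have [V [a [VV ea Aeq _]]] := matfun_spectral Asym.
pose w := V^T *m (Q *m v^T).
have vv : dot w w = dot v^T v^T.
  by rewrite -!sqr_norm2 !norm2_isometry // trmxK (mulmx1C VV).
have ww0 : 0 < dot w w by rewrite vv dot_gt0 trmx_eq0.
have ray : mu * dot w w = \sum_i a 0 i * (w i 0 * w i 0).
  transitivity (dot w (diag_mx a *m w)).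
    rewrite vv -dotZr -linearZ /= -vT !trmx_mul trmxK Asym.
    rewrite Aeq /w dot_mulmx trmxK dot_mulmx !mulmxA.
    by rewrite -!mulmxA.
  by rewrite dotE; apply: eq_bigr => i _; rewrite mul_diag_mx !mxE mulrCA.
have cmp c : c * dot w w = \sum_i c * (w i 0 * w i 0) by rewrite dotE mulr_sumr.
rewrite -(ler_pM2r ww0) -[X in _ && X](ler_pM2r ww0) ray !cmp.
by apply/andP; split; apply: ler_sum => i _; rewrite ler_wpM2r -?expr2 ?sqr_ge0 //;
  case/andP: (lu _ (ea i)).
Qed.

End MatrixFunctions.

(** * The error of the best polynomial *)

Section PolynomialError.
Context {R : realType}.

Lemma deg0_lt (t : R) : (deg (0 : {poly R}) < t%:E)%E.
Proof. by rewrite /deg eqxx ltNyr. Qed.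

(** A characterization by coefficients, which is visibly stable under linear
    combinations. *)
Lemma deg_ltP (t : R) (p : {poly R}) :
  (deg p < t%:E)%E <-> (forall i, p`_i != 0 -> i%:R < t).
Proof.
rewrite /deg; have [->|p0] := eqVneq p 0.
  by rewrite ltNyr; split=> // _ i; rewrite coef0 eqxx.
rewrite lte_fin; split=> [pt i pi|]; last by apply; rewrite -lead_coefE lead_coef_eq0.
apply: le_lt_trans pt; rewrite ler_nat.
have : (i < size p)%N by rewrite ltnNge; apply: contra pi => /(nth_default 0) ->.
by case: (size p).
Qed.

Lemma deg_lin_lt (t : R) a (p q : {poly R}) :
  (deg p < t%:E)%E -> (deg q < t%:E)%E -> (deg (a *: p + q) < t%:E)%E.
Proof.
rewrite !deg_ltP => hp hq i; rewrite coefD coefZ => apq.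
have [pi|pi] := eqVneq p`_i 0; last exact: hp.
by apply: hq; move: apq; rewrite pi mulr0 add0r.
Qed.

(** The vectors [matfun (horner p) A *m b] with [deg p < t] form a subspace, so
    the distance to it is attained. *)
Lemma min_poly_error_spec {d} (A : 'M[R]_d) b v (t : R) :
  (exists2 p : {poly R}, (deg p < t%:E)%E &
    min_poly_error A b v t = norm2 (v - matfun (horner p) A *m b)) /\
  (forall p : {poly R}, (deg p < t%:E)%E ->
    min_poly_error A b v t <= norm2 (v - matfun (horner p) A *m b)).
Proof.
pose D x := exists2 p : {poly R}, (deg p < t%:E)%E & x = matfun (horner p) A *m b.
have D0 : D 0.
  exists 0; first exact: deg0_lt.
  rewrite /matfun big1 ?mul0mx // => i _; by rewrite horner0 scale0r.
have Dlin a x y : D x -> D y -> D (a *: x + y).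
  move=> [p pt ->] [q qt ->]; exists (a *: p + q); first exact: deg_lin_lt.
  have -> : horner (a *: p + q) = (fun x => a * p.[x] + q.[x]).
    by apply/funext => z; rewrite hornerD hornerZ.
  by rewrite matfun_lin mulmxDl scalemxAl.
have [_ [p pt ->] pmin] := closest_point v D0 Dlin.
rewrite /min_poly_error /minimum.
set S := [set _ | _ in _].
have [|[q qt <-] lbq] := @xgetPex _ 0 [set m | S m /\ lbound S m].
  exists (norm2 (v - matfun (horner p) A *m b)); split; first by exists p.
  by move=> _ [q qt <-]; apply: pmin; exists q.
by split; [exists q|move=> q' q't; apply: lbq; exists q'].
Qed.

End PolynomialError.

(** * Lanczos-FA *)

Section LanczosFA.
Context {R : realType}.

(** Both iterates are built on the same [Q] and [T], so their difference is the
    iterate of [f - g]. *)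
Lemma norm2_lan_diff_le {d} (A : 'M[R]_d) (b : 'cV_d) k (f g : R -> R)
    (l u U : R) :
  A^T = A -> (forall a, eigenvalue A a -> l <= a <= u) -> 0 <= U ->
  (forall x, l <= x <= u -> `|f x - g x| <= U) ->
  norm2 (lan k f A b - lan k g A b) <= U * norm2 b.
Proof.
move=> Asym lu U0 fgU; have QQ := lanczos_isometry A b k.
have Tsym : (lanczos_T A b k)^T = lanczos_T A b k.
  by rewrite /lanczos_T !trmx_mul trmxK Asym mulmxA.
rewrite /lan -!mulmxA -mulmxBr norm2_isometry // -mulmxBl matfunB.
have eT a : eigenvalue (lanczos_T A b k) a -> `|f a - g a| <= U.
  by move=> /(eigenvalue_compression Asym QQ lu); apply: fgU.
apply: le_trans (norm2_matfun_le _ Tsym eT) _.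
by rewrite ler_wpM2l // norm2_tr_isometry.
Qed.

Lemma lan_error_le {d} (A : 'M[R]_d) (b : 'cV_d) k (f g : R -> R)
    (l u U C t : R) :
  A^T = A -> (forall a, eigenvalue A a -> l <= a <= u) -> 0 <= U -> 0 <= C ->
  (forall x, l <= x <= u -> `|f x - g x| <= U) ->
  norm2 (matfun g A *m b - lan k g A b)
    <= C * min_poly_error A b (matfun g A *m b) t ->
  norm2 (matfun f A *m b - lan k f A b)
    <= (C + 2) * norm2 b * U + C * min_poly_error A b (matfun f A *m b) t.
Proof.
move=> Asym lu U0 C0 fgU near.
have fg : norm2 (matfun f A *m b - matfun g A *m b) <= U * norm2 b.
  by rewrite -mulmxBl matfunB; apply: norm2_matfun_le => // a /lu; apply: fgU.
have lanfg : norm2 (lan k g A b - lan k f A b) <= U * norm2 b.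
  by apply: (norm2_lan_diff_le b k Asym lu U0) => x lxu; rewrite distrC fgU.
have [[p pt pmin] _] := min_poly_error_spec A b (matfun f A *m b) t.
have [_ /(_ p pt) gmin] := min_poly_error_spec A b (matfun g A *m b) t.
have {gmin} : min_poly_error A b (matfun g A *m b) t
    <= U * norm2 b + min_poly_error A b (matfun f A *m b) t.
  apply: le_trans gmin _; rewrite pmin.
  have -> : matfun g A *m b - matfun (horner p) A *m b =
      - (matfun f A *m b - matfun g A *m b) +
      (matfun f A *m b - matfun (horner p) A *m b).
    by rewrite opprB addrA subrK.
  by rewrite (le_trans (norm2D _ _)) // lerD2r norm2N.
move=> /(ler_wpM2l C0) gmin.
have -> : matfun f A *m b - lan k f A b =
    (matfun f A *m b - matfun g A *m b) +
    (matfun g A *m b - lan k g A b) + (lan k g A b - lan k f A b).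
  by rewrite !subrKA.
apply: le_trans (norm2D _ _) _.
apply: le_trans (lerD (norm2D _ _) (lexx _)) _.
by lra.
Qed.

End LanczosFA.

Unset Implicit Arguments.

Theorem lemma5 (R : realType) (d : nat) (A : 'M[R]_d) (lmin lmax : R)
    (b : 'cV[R]_d) (k : nat) (f : R -> R)
    (RR : set {fraction {poly R}}) (C c : {fraction {poly R}} -> R)
    (A_sym : A^T = A)
    (lmin_eig : eigenvalue A lmin)
    (lmin_le : forall mu : R, eigenvalue A mu -> lmin <= mu)
    (lmax_eig : eigenvalue A lmax)
    (lmax_ge : forall mu : R, eigenvalue A mu -> mu <= lmax)
    (k_ge1 : (1 <= k)%N)
    (RR_neq0 : RR !=set0)
    (RR_poles : forall r : {fraction {poly R}}, RR r ->
       forall x : R, x \in `[lmin, lmax] -> ~~ ratfun_pole r x)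
    (C_ge1 : forall r : {fraction {poly R}}, RR r -> 1 <= C r)
    (c_le1 : forall r : {fraction {poly R}}, RR r -> c r <= 1)
    (near_opt : forall r : {fraction {poly R}}, RR r ->
       norm2 (matfun (ratfun_eval r) A *m b - lan k (ratfun_eval r) A b)
       <= C r * min_poly_error A b (matfun (ratfun_eval r) A *m b) (c r * k%:R)) :
  ((norm2 (matfun f A *m b - lan k f A b)%R)%:E <=
   ereal_inf
     [set ((C r + 2) * norm2 b)%R%:E
            * unif_norm `[lmin, lmax] (fun x => (f x - ratfun_eval r x)%R)
          + (C r * min_poly_error A b (matfun f A *m b) (c r * k%:R))%R%:E
     | r in RR])%E.
Proof.
have lu a : eigenvalue A a -> lmin <= a <= lmax.
  by move=> ea; rewrite lmin_le ?lmax_ge.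
apply: le_ereal_inf_tmp => _ [r Rr <-].
set N := unif_norm _ _.
have fN x : lmin <= x <= lmax -> (`|f x - ratfun_eval r x|%:E <= N)%E.
  by move=> lx; apply: ereal_sup_ubound; exists x.
have N0 : (0 <= N)%E.
  apply: le_trans (fN lmin _); first by rewrite lee_fin.
  by rewrite lexx lmin_le.
have C0 : 0 <= C r by rewrite (le_trans ler01) // C_ge1.
case E : N => [U| |].
- rewrite -EFinM -EFinD lee_fin; move: N0 fN; rewrite E lee_fin => U0 fU.
  by apply: (lan_error_le A_sym lu U0 C0 _ (near_opt r Rr)) => x /fU; rewrite lee_fin.
(* In the extended reals [0 * +oo = 0], so [b = 0] has to be treated apart. *)
- have [b0|b0] := eqVneq b 0.
    have /eqP n0 : norm2 b == 0 by rewrite norm2_eq0 b0.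
    have [[p _ pmin] _] :=
      min_poly_error_spec A b (matfun f A *m b) (c r * k%:R).
    rewrite n0 mulr0 mul0e add0e lee_fin pmin.
    have -> : norm2 (matfun f A *m b - lan k f A b) = 0.
      by rewrite b0 /lan !mulmx0 subrr -b0.
    by rewrite mulr_ge0 ?norm2_ge0.
  rewrite gt0_muley ?addye ?leey // lte_fin mulr_gt0 //.
    by rewrite ltr_wpDl.
  by rewrite lt_def norm2_ge0 norm2_eq0 b0.
- by move: N0; rewrite E.
Qed.
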